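(* Let $(X,T)$ be a topological space. Then: (i) $(X,T)$ is functionally separated iff $x\ne y\Rightarrow\mu_Z(x)\cap\mu_Z(y)=\emptyset$ for any $x,y\in X$. (ii) $(X,T)$ is completely regular iff $x\notin F\Rightarrow\mu_Z(x)\cap\mu_Z(F)=\emptyset$ for any $x\in X$ and any closed $F\subseteq X$. (iii) $(X,T)$ is normal iff $F_1\cap F_2=\emptyset\Rightarrow\mu_Z(F_1)\cap\mu_Z(F_2)=\emptyset$ for any closed subsets $F_1,F_2$ of $X$.
   Context: Nonstandard setting. Let $S\supseteq X\cup\mathbb R$ be a set of individuals, with superstructure $V(S)=\bigcup_{k\ge 0}V_k(S)$, $V_0(S)=S$, $V_{k+1}(S)=V_k(S)\cup\mathcal P(V_k(S))$. A $\kappa$-saturated nonstandard model of $S$ is a superstructure $V({}^*S)$ with a map $A\mapsto {}^*A$ from $V(S)$ into $V({}^*S)$ satisfying: (Extension) ${}^*s=s$ for all $s\in S$; (Transfer) a bounded quantifier formula $\Phi(A_1,\dots,A_n)$ with constants in $V(S)$ is true iff $\Phi({}^*A_1,\dots,{}^*A_n)$ is true in $V({}^*S)$; (Saturation) every family of at most $\kappa$ internal sets with the finite intersection property has nonempty intersection. An entity of $V({}^*S)$ is internal if it is an element of ${}^*A$ for some $A\in V(S)$. Throughout, a $\kappa$-saturated model with $\kappa$ infinite and $\kappa>\operatorname{card}T$ is fixed; $X\subseteq {}^*X$. $Z=\{f^{-1}[\{0\}]:f\in C(X,\mathbb R)\}$ is the family of zero sets of continuous real-valued functions on $(X,T)$.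 For $\alpha\in{}^*X$, $\mu_Z(\alpha)=\bigcap\{{}^*G:G\in Z,\ \alpha\in{}^*G\}$; for $A\subseteq{}^*X$, $\mu_Z(A)=\bigcap\{{}^*G:G\in Z,\ A\subseteq{}^*G\}$. $(X,T)$ is functionally separated if for any $x\ne y$ in $X$ there is a continuous $f:X\to\mathbb R$ with $f(x)=0$, $f(y)=1$. $(X,T)$ is completely regular if for every closed $F\subseteq X$ and $x\in X\setminus F$ there is a continuous $f:X\to[0,1]$ with $f(x)=0$ and $F\subseteq f^{-1}[\{1\}]$. Completely regular and normal do not include any $T_1$ or Hausdorff requirement. *)

(* Defs.v *)
From HB Require Import structures.
From mathcomp Require Import all_boot all_order all_algebra.
From mathcomp Require Import all_classical all_reals all_analysis.
Import Order.TTheory GRing.Theory Num.Theory numFieldNormedType.Exports.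

Set Implicit Arguments.
Unset Strict Implicit.
Unset Printing Implicit Defensive.

Local Open Scope classical_set_scope.
Local Open Scope card_scope.
Local Open Scope ring_scope.

(* The k-th stage V_k(S): V_0 = S and V_{k+1} = V_k `|` P(V_k), for individuals
   [atom : S -> E] and membership "x belongs to A" written [elts A x]. The
   entities outside [range atom] are the sets. *)
Fixpoint level (S E : Type) (atom : S -> E) (elts : E -> set E) (k : nat) :
    set E :=
  if k is j.+1 then
    level atom elts j `|`
      [set A | ~ range atom A /\ elts A `<=` level atom elts j]
  else range atom.

(* The superstructure V(S), determined by these axioms up to a unique
   isomorphism over S: individuals have no elements, sets are extensional,
   every subset P of a stage V_k(S) is represented by a set [setof P], and V(S)
   is the union of its stages. [setof P] is meaningful only for such P. *)
Record superstructure (S : Type) := Superstructure {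
  entity :> Type;
  atom : S -> entity;
  elts : entity -> set entity;
  setof : set entity -> entity;
  atom_inj : injective atom;
  elts_atom : forall s : S, elts (atom s) = set0;
  elts_inj : forall A B : entity, ~ range atom A -> ~ range atom B ->
    elts A = elts B -> A = B;
  setofP : forall (k : nat) (P : set entity), P `<=` level atom elts k ->
    ~ range atom (setof P) /\ elts (setof P) = P;
  levelP : forall A : entity, exists k : nat, level atom elts k A
}.

Arguments atom {S} V s : rename.
Arguments elts {S V} A : rename.
Arguments setof {S} V P : rename.

Definition is_set (S : Type) (V : superstructure S) (A : V) : Prop :=
  ~ range (atom V) A.

(* Bounded quantifier formulas in the language of membership and equality, with
   de Bruijn variables: [BAll i p] is "for all x in v_i, p", where x becomes
   variable 0 of p and the other variables are shifted by one. The free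
   variables of a formula are the slots of its constants. *)
Inductive bqf : Type :=
| BMem of nat & nat
| BEq of nat & nat
| BNot of bqf
| BAnd of bqf & bqf
| BOr of bqf & bqf
| BImp of bqf & bqf
| BAll of nat & bqf
| BEx of nat & bqf.

Definition scons (T : Type) (x : T) (v : nat -> T) (n : nat) : T :=
  if n is m.+1 then v m else x.

Fixpoint holds (S : Type) (V : superstructure S) (v : nat -> V) (p : bqf) :
    Prop :=
  match p with
  | BMem i j => elts (v j) (v i)
  | BEq i j => v i = v j
  | BNot p => ~ holds v p
  | BAnd p q => holds v p /\ holds v q
  | BOr p q => holds v p \/ holds v q
  | BImp p q => holds v p -> holds v q
  | BAll i p => forall x : V, elts (v i) x -> holds (scons x v) p
  | BEx i p => exists2 x : V, elts (v i) x & holds (scons x v) p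
  end.

Definition internal (S S' : Type) (V : superstructure S)
    (V' : superstructure S') (star : V -> V') (A : V') : Prop :=
  exists B : V, elts (star B) A.

Definition fin_inter_property (S : Type) (V : superstructure S) (F : set V) :
    Prop :=
  forall G : set V, finite_set G -> G `<=` F ->
    \bigcap_(A in G) elts A !=set0.

(* A kappa-saturated nonstandard model of S, the cardinal kappa being that of
   the type K. [nsS] is the set *S of individuals of the nonstandard universe
   [nsV] = V( *S), as stated by [star_indiv], and [incl] is the inclusion of S
   in *S, so that [extension] reads *s = s. *)
Record nonstandard_model (K S : Type) (V : superstructure S) :=
    NonstandardModel {
  nsS : Type;
  nsV : superstructure nsS;
  incl : S -> nsS;
  incl_inj : injective incl;
  star : V -> nsV;
  star_indiv : elts (star (setof V (range (atom V)))) = range (atom nsV);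
  extension : forall s : S, star (atom V s) = atom nsV (incl s);
  transfer : forall (p : bqf) (v : nat -> V),
    holds v p <-> holds (fun i => star (v i)) p;
  saturation : forall F : set nsV, F #<= [set: K] ->
    (forall A : nsV, F A -> is_set A /\ internal star A) ->
    fin_inter_property F -> \bigcap_(A in F) elts A !=set0
}.

Definition zero_sets (R : realType) (X : topologicalType) : set (set X) :=
  [set G | exists2 f : X -> R, continuous f & G = f @^-1` [set 0]].

Section Monads.
Variables (K S : Type) (V : superstructure S) (M : nonstandard_model K V).
Variables (R : realType) (X : topologicalType) (iX : X -> S).

(* The point x of X, seen in *X through X `<=` S `<=` *S. *)
Definition std_point (x : X) : nsV M := atom (nsV M) (incl M (iX x)).

(* *A for A `<=` X; in particular [star_of setT] is *X. *)
Definition star_of (A : set X) : set (nsV M) :=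
  elts (star M (setof V [set atom V (iX x) | x in A])).

Definition muZ_point (a : nsV M) : set (nsV M) :=
  \bigcap_(G in [set G | zero_sets R G /\ star_of G a]) star_of G.

Definition muZ_set (A : set (nsV M)) : set (nsV M) :=
  \bigcap_(G in [set G | zero_sets R G /\ A `<=` star_of G]) star_of G.

End Monads.

Definition functionally_separated (R : realType) (X : topologicalType) : Prop :=
  forall x y : X, x <> y ->
    exists f : X -> R, [/\ continuous f, f x = 0 & f y = 1].

(* The library's [completely_regular_space] is stated with uniform structures;
   this is the definition by real-valued functions. No separation axiom is
   included. *)
Definition completely_regular (R : realType) (X : topologicalType) : Prop :=
  forall (F : set X) (x : X), closed F -> ~ F x ->
    exists f : X -> R, [/\ continuous f, (forall z : X, 0 <= f z <= 1),
      f x = 0 & F `<=` f @^-1` [set 1]].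

(* Main.v *)
Require Import Defs.
From HB Require Import structures.
From mathcomp Require Import all_boot all_order all_algebra.
From mathcomp Require Import all_classical all_reals all_analysis.
Import Order.TTheory GRing.Theory Num.Theory numFieldNormedType.Exports.
Local Open Scope classical_set_scope.
Local Open Scope card_scope.
Local Open Scope ring_scope.

(** For subsets [F1] and [F2] of [X], the Z-monads of their standard points are
    disjoint iff [F1] and [F2] lie in disjoint zero sets. One direction is
    transfer. For the other, the zero sets [G `&` H] with [F1 `<=` G] and
    [F2 `<=` H] are closed under finite intersections, and there are at most as
    many as open sets, so if they are all nonempty then saturation puts a point
    in both monads. Disjoint zero sets of [f] and [g] are separated by
    [|f| / (|f| + |g|)], and Urysohn's lemma handles the normal case. *)

Section StarOf.
Variables (K S : Type) (V : superstructure S) (M : nonstandard_model K V).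

(** Being an individual is membership in one standard set, which [star_indiv] identifies in [nsV M],
    so transfer applies to it. *)
Lemma star_is_set (A : V) : is_set A -> is_set (star M A).
Proof.
move=> setA; rewrite /is_set -star_indiv => sA; apply: setA.
have [_ <-] := @setofP _ V 0 (range (atom V)) (@subset_refl _ _).
(* Slot 0 holds [A]; every later slot holds the set of individuals. *)
exact/(transfer M (BMem 0 1) (scons A (fun=> setof V (range (atom V))))).
Qed.

(** [A] lies in some stage, so its singleton is coded by an entity, and the membership of [A] in
    that entity transfers. *)
Lemma star_internal (A : V) : internal (star M) (star M A).
Proof.
have [k Ak] := levelP A.
have A1k : [set A] `<=` level (atom V) elts k by move=> _ ->.
have [_ EA] := setofP A1k.
exists (setof V [set A]).
apply: (transfer M (BMem 0 1) (scons A (fun=> setof V [set A]))).1 => /=.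
by rewrite EA.
Qed.

Variables (X : topologicalType) (iX : X -> S).

Local Notation stdset := (@star_of _ _ _ M _ iX).
Local Notation code A := (setof V [set atom V (iX x) | x in A]).

Lemma code_subset (A : set X) :
  is_set (code A) /\ elts (code A) = [set atom V (iX x) | x in A].
Proof. by apply: (@setofP _ V 0) => _ [x _ <-]; exists (iX x). Qed.

Lemma star_of_std_point (iX_inj : injective iX) (A : set X) (x : X) :
  stdset A (std_point M iX x) <-> A x.
Proof.
rewrite /star_of /std_point -extension.
have := transfer M (BMem 0 1) (scons (atom V (iX x)) (fun=> code A)).
rewrite /= (code_subset A).2 => <-; split=> [[y Ay eyx]|Ax]; last by exists x.
by rewrite -(iX_inj _ _ (atom_inj eyx)).
Qed.

Lemma star_ofS (A B : set X) : A `<=` B -> stdset A `<=` stdset B.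
Proof.
move=> AB.
(* Under the binder the slots shift by one: index 2 is slot 1, that is [code B]. *)
have := transfer M (BAll 0 (BMem 0 2)) (scons (code A) (fun=> code B)).
rewrite /= (code_subset A).2 (code_subset B).2 => -[+ _].
by apply=> _ [x Ax <-]; exists x => //; exact: AB.
Qed.

(** One inclusion is monotonicity. The other transfers a bounded formula on the codes; [iX_inj]
    ensures that an atom common to both codes comes from a single point of [X]. *)
Lemma star_ofI (iX_inj : injective iX) (A B : set X) :
  stdset (A `&` B) = stdset A `&` stdset B.
Proof.
apply/seteqP; split=> [a sa|a [sAa sBa]].
  by split; [exact: star_ofS (@subIsetl _ A B) _ sa
            |exact: star_ofS (@subIsetr _ A B) _ sa].
have := transfer M (BAll 0 (BImp (BMem 0 2) (BMem 0 3)))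
  (scons (code A) (scons (code B) (fun=> code (A `&` B)))).
rewrite /= (code_subset A).2 (code_subset B).2 (code_subset (A `&` B)).2.
move=> -[+ _]; apply=> // _ [x Ax <-] [y By eyx].
by exists x => //; split=> //; rewrite -(iX_inj _ _ (atom_inj eyx)).
Qed.

Lemma star_of0 : stdset set0 = set0.
Proof.
rewrite -subset0 => a sa.
(* Emptiness as a bounded formula: every element differs from itself. *)
have := transfer M (BAll 0 (BNot (BEq 0 0))) (fun=> code set0).
rewrite /= (code_subset set0).2 => tr; apply: (tr.1 _ a sa erefl).
by move=> x [y []].
Qed.

(** The extensions of members of [B] form a filter base, proper because each contains a standard
    point. This gives the finite intersection property that saturation requires. *)
Lemma bigcap_star_of_neq0 (iX_inj : injective iX) (B : set (set X)) :
  B #<= [set: K] -> B !=set0 ->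
  (forall G H, B G -> B H -> B (G `&` H)) ->
  (forall G, B G -> G !=set0) ->
  \bigcap_(G in B) stdset G !=set0.
Proof.
move=> BK B0 BI Bn0.
have star_filter : Filter (filter_from B stdset).
  apply: filter_from_filter => // G H BG BH.
  by exists (G `&` H); [exact: BI|rewrite star_ofI].
have star_proper : ProperFilter (filter_from B stdset).
  apply: filter_from_proper => G /Bn0 [x Gx].
  by exists (std_point M iX x); exact/star_of_std_point.
pose F := [set star M (code G) | G in B].
have [||E FE FB|a Fa] := @saturation _ _ _ M F.
- exact: card_le_trans (card_image_le _ _) BK.
- move=> _ [G _ <-]; split; last exact: star_internal.
  by apply: star_is_set; exact: (code_subset G).1.
- apply: (@filter_ex _ (filter_from B stdset)).
  (* [{classic _}] supplies the choice structure needed to list the finite family. *)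
  move: FE => /(@finite_fsetP {classic (nsV M)}) [D DE].
  rewrite DE; apply: (@filter_bigI _ {classic (nsV M)}) => A DA.
  have [|G BG <-] := FB A; first by rewrite DE.
  by exists G.
- by exists a => G BG; apply: Fa; exists G.
Qed.

End StarOf.

Section ZeroSets.
Variables (R : realType) (X : topologicalType).

Lemma zero_setsT : zero_sets R (@setT X).
Proof. by exists (fun=> 0); [exact: cst_continuous|apply/seteqP]. Qed.

Lemma zero_setsI (G H : set X) :
  zero_sets R G -> zero_sets R H -> zero_sets R (G `&` H).
Proof.
move=> [f cf ->] [g cg ->]; exists (fun x => `|f x| + `|g x|).
  by move=> x; apply: cvgD; apply: cvg_norm; [exact: cf|exact: cg].
apply/seteqP; split=> x /=; first by move=> [-> ->]; rewrite normr0 addr0.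
by move=> /eqP; rewrite paddr_eq0// !normr_eq0 => /andP[/eqP ? /eqP ?].
Qed.

Lemma zero_sets_closed : @zero_sets R X `<=` @closed X.
Proof.
by move=> _ [f cf ->]; move/continuous_closedP: cf; apply; exact: closed_eq.
Qed.

(** Every zero set is the complement of an open set. This carries the cardinal bound on the topology
    over to zero sets. *)
Lemma card_zero_sets : @zero_sets R X #<= [set A : set X | open A].
Proof.
apply: card_le_trans (card_image_le (@setC X) _); apply: subset_card_le.
by move=> G /zero_sets_closed/closed_openC oG; exists (~` G); rewrite // setCK.
Qed.

Lemma zero_sets_uniform_separator (A B G H : set X) :
  zero_sets R G -> zero_sets R H -> A `<=` G -> B `<=` H -> G `&` H = set0 ->
  uniform_separator A B.
Proof.
move=> [f cf ->] [g cg ->] Af Bg fg0; apply/(@uniform_separatorP _ R).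
(* The denominator vanishes only on [G] [&] [H], which is empty. *)
have fg_gt0 x : 0 < `|f x| + `|g x|.
  rewrite lt_neqAle eq_sym addr_ge0// andbT paddr_eq0// !normr_eq0.
  apply/negP => /andP[/eqP fx /eqP gx].
  by have : (set0 : set X) x by rewrite -fg0.
exists (fun x => `|f x| / (`|f x| + `|g x|)); split.
- move=> x; apply: cvgM; first by apply: cvg_norm; exact: cf.
  apply: cvgV; first by rewrite gt_eqF.
  by apply: cvgD; apply: cvg_norm; [exact: cf|exact: cg].
- move=> _ [x _ <-]; rewrite /= in_itv/= divr_ge0// ?(ltW (fg_gt0 x))//=.
  by rewrite ler_pdivrMr// mul1r lerDl.
- by move=> _ [x /Af/= -> <-]; rewrite normr0 mul0r.
- move=> _ [x /Bg/= gx <-]; have := fg_gt0 x.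
  by rewrite gx normr0 addr0 /= => /lt0r_neq0 /divff.
Qed.

End ZeroSets.

Section MonadsOfStandardSets.
Variables (K S : Type) (V : superstructure S) (M : nonstandard_model K V).
Variables (R : realType) (X : topologicalType).
Variables (iX : X -> S) (iX_inj : injective iX).
Local Notation stdset := (@star_of _ _ _ M _ iX).
Hypothesis open_K : [set A : set X | open A] #<= [set: K].

(** Lets the statements about points be treated as statements about singletons. *)
Lemma muZ_pointE (a : nsV M) : muZ_point R iX a = muZ_set R iX [set a].
Proof.
rewrite /muZ_point /muZ_set; congr bigcap.
apply/seteqP; split=> G [zG Ga]; split=> //.
  by move=> _ ->.
exact: Ga.
Qed.

(** Shows that the zero sets defining the monad of the standard points of [F] are those containing
    [F] in [X]. *)
Lemma sub_star_of (F G : set X) :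
  (std_point M iX @` F `<=` stdset G) = (F `<=` G).
Proof.
apply/propext; split=> FG x.
  by move=> Fx; apply/(star_of_std_point _ _ _ M _ _ iX_inj)/FG; exists x.
by case=> y /FG Gy <-; apply/star_of_std_point.
Qed.

(** The fibres of [f] over 0 and 1 are disjoint zero sets, so their extensions are disjoint, and
    each contains one of the monads. *)
Lemma muZ_set_disjoint (F1 F2 : set X) (f : X -> R) :
  continuous f -> F1 `<=` f @^-1` [set 0] -> F2 `<=` f @^-1` [set 1] ->
  muZ_set R iX (std_point M iX @` F1) `&`
    muZ_set R iX (std_point M iX @` F2) = set0.
Proof.
move=> cf F10 F21; rewrite -subset0 => a [mu1 mu2].
pose G := f @^-1` [set 0]; pose H := f @^-1` [set 1].
have GH0 : G `&` H = set0.
  rewrite -subset0 => x [fx0 fx1]; have := oner_neq0 R.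
  by rewrite -fx1 fx0 eqxx.
have : ~ stdset (G `&` H) a by rewrite GH0 star_of0.
rewrite star_ofI//; apply; split.
  by apply: mu1; split; [exists f|rewrite sub_star_of].
apply: mu2; split; last by rewrite sub_star_of.
exists (fun x => f x - 1).
  by move=> x; apply: cvgB; [exact: cf|exact: cvg_cst].
apply/seteqP; split=> x /=; first by move=> ->; rewrite subrr.
by move=> /eqP; rewrite subr_eq0 => /eqP.
Qed.

Lemma muZ_set_disjoint_separator (F1 F2 : set X) :
  muZ_set R iX (std_point M iX @` F1) `&`
    muZ_set R iX (std_point M iX @` F2) = set0 ->
  uniform_separator F1 F2.
Proof.
move=> mu0; apply: contrapT => nsep.
pose B : set (set X) := [set GH | exists G H, [/\ zero_sets R G,
  zero_sets R H, F1 `<=` G, F2 `<=` H & GH = G `&` H]].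
have [||||a Ba] := @bigcap_star_of_neq0 _ _ _ M _ _ iX_inj B.
(* Each [G] [&] [H] is itself a zero set, so [B] is no larger than the topology. *)
- apply: card_le_trans open_K; apply: card_le_trans (card_zero_sets R X).
  by apply: subset_card_le => _ [G [H [zG zH _ _ ->]]]; exact: zero_setsI.
- exists (setT `&` setT), setT, setT.
  by split=> //; exact: zero_setsT.
- move=> _ _ [G [H [zG zH FG FH ->]]] [G' [H' [zG' zH' FG' FH' ->]]].
  exists (G `&` G'), (H `&` H'); split.
  + exact: zero_setsI.
  + exact: zero_setsI.
  + by rewrite subsetI.
  + by rewrite subsetI.
  + exact: setIACA.
- move=> _ [G [H [zG zH FG FH ->]]]; apply/set0P/eqP => GH0; apply: nsep.
  exact: zero_sets_uniform_separator zG zH FG FH GH0.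
suff : (set0 : set (nsV M)) a by [].
(* Pairing [G] with [setT] as the other zero set puts [a] in the extension of [G] alone. *)
rewrite -mu0; split=> G [zG].
  rewrite sub_star_of => FG.
  have : stdset (G `&` setT) a.
    by apply: Ba; exists G, setT; split=> //; exact: zero_setsT.
  by rewrite setIT.
rewrite sub_star_of => FG.
have : stdset (setT `&` G) a.
  by apply: Ba; exists setT, G; split=> //; exact: zero_setsT.
by rewrite setTI.
Qed.

End MonadsOfStandardSets.

Theorem mainTheorem12 (R : realType) (X : topologicalType)
    (S : Type) (iX : X -> S) (iX_inj : injective iX)
    (iR : R -> S) (iR_inj : injective iR)
    (K : Type) (K_infinite : infinite_set [set: K])
    (K_ge : [set A : set X | open A] #<= [set: K])
    (K_neq : ~ ([set: K] #<= [set A : set X | open A]))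
    (V : superstructure S) (M : nonstandard_model K V) :
  [/\ functionally_separated R X <->
        (forall x y : X, x <> y ->
           muZ_point R iX (std_point M iX x)
             `&` muZ_point R iX (std_point M iX y) = set0),
      completely_regular R X <->
        (forall (x : X) (F : set X), closed F -> ~ F x ->
           muZ_point R iX (std_point M iX x)
             `&` muZ_set R iX (std_point M iX @` F) = set0)
    & normal_space X <->
        (forall F1 F2 : set X, closed F1 -> closed F2 -> F1 `&` F2 = set0 ->
           muZ_set R iX (std_point M iX @` F1)
             `&` muZ_set R iX (std_point M iX @` F2) = set0)].
Proof.
have sep := @muZ_set_disjoint_separator _ _ _ M R _ _ iX_inj K_ge.
have disj := @muZ_set_disjoint _ _ _ M R _ _ iX_inj.
split; split.
- move=> fs x y /fs[f [cf fx fy]].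
  rewrite !muZ_pointE -!(image_set1 (std_point M iX)).
  by apply: disj cf _ _ => _ ->.
- move=> mu0 x y /mu0.
  rewrite !muZ_pointE -!(image_set1 (std_point M iX)).
  move=> /sep/(@uniform_separatorP _ R)[f [cf _ fx fy]].
  by exists f; split=> //; [apply: fx; exists x|apply: fy; exists y].
- move=> cr x F cF /(cr _ _ cF)[f [cf _ fx fF]].
  rewrite muZ_pointE -(image_set1 (std_point M iX)).
  by apply: disj cf _ fF => _ ->.
- move=> mu0 F x cF /(mu0 _ _ cF).
  rewrite muZ_pointE -(image_set1 (std_point M iX)).
  move=> /sep/(@uniform_separatorP _ R)[f [cf f01 fx fF]].
  exists f; split=> //.
  + by move=> z; have := f01 (f z) (imageT f z); rewrite /= in_itv.
  + by apply: fx; exists x.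
  + by move=> y Fy; apply: fF; exists y.
(* Urysohn's lemma: normality amounts to uniform separation of disjoint closed sets. *)
- move=> /(@normal_separatorP R) nX F1 F2 cF1 cF2 F120.
  have /(@uniform_separatorP _ R)[f [cf _ f0 f1]] := nX _ _ cF1 cF2 F120.
  by apply: (disj _ _ f) => // x Fx; [apply: f0|apply: f1]; exists x.
- move=> mu0; apply/(@normal_separatorP R) => F1 F2 cF1 cF2 F120.
  exact/sep/mu0.
Qed.
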